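(* Let $\Gamma=(\mathcal V,b,c)$ be a canonically compactifiable weighted graph over $(\mathcal V,m)$ satisfying the growth assumption on the potential $V$, let $f:\mathcal V\times\mathbb R\to\mathbb R$ satisfy $(f_1)$–$(f_4)$, let $\lambda\in\mathbb R$ and $\kappa\in\{1,-1\}$. If $$\inf_{\mathcal K\subset\mathcal V,\ m(\mathcal K)<\infty}\ \sum_{x\in\mathcal V\setminus\mathcal K}\frac{(m(x))^2}{m(x)+c(x)}<\infty,$$ then every solution $u\in E$ of $$-\Delta u(x)+V(x)u(x)-\lambda u(x)=\kappa f(x,u(x)),\qquad x\in\mathcal V,$$ belongs to $\ell^p_m$ for all $p\in[1,\infty]$.
   Context: Let $\mathcal V$ be an infinite countable set and $m:\mathcal V\to(0,\infty)$; put $m(A)=\sum_{x\in A}m(x)$ for $A\subset\mathcal V$. A weighted graph $\Gamma=(\mathcal V,b,c)$ over $(\mathcal V,m)$ consists of an edge weight $b:\mathcal V\times\mathcal V\to[0,\infty)$ with $b(x,x)=0$, $b(x,y)=b(y,x)$, $\sum_{y}b(x,y)<\infty$ for all $x,y\in\mathcal V$, and a killing term $c:\mathcal V\to[0,\infty)$. Write $x\sim y$ iff $b(x,y)>0$. Put $V(x)=\frac{c(x)+m(x)}{m(x)}\ge 1$ and $\Delta u(x)=\frac1{m(x)}\sum_{y\sim x}b(x,y)(u(y)-u(x))$. For $p\in[1,\infty)$, $\ell^p_m$ is the space of $u:\mathcal V\to\mathbb R$ with $\|u\|_{\ell^p_m}^p=\sum_x m(x)|u(x)|^p<\infty$; $\ell^\infty_m=\ell^\infty$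 is the space of bounded functions with sup-norm; $(u,v)_m=\sum_x m(x)u(x)v(x)$. Forms: $q^{(N)}(u)=\frac12\sum_{x,y\in\mathcal V,\,x\sim y}b(x,y)(u(y)-u(x))^2+\sum_x m(x)V(x)u(x)^2$ with domain $D(q^{(N)})=\{u\in\ell^2_m: q^{(N)}(u)<\infty\}$, normed by $q^{(N)}(u)^{1/2}$. $q^{(D)}$ is the closure in $\ell^2_m$ of the form $q_0(u)=\sum_x m(x)(-\Delta u(x)+V(x)u(x))u(x)$ on finitely supported functions. Fix a closed form $q$ with $D(q^{(D)})\subset D(q)\subset D(q^{(N)})$ and $q=q^{(N)}$ on $D(q)$; $E=D(q)$ is a Hilbert space with norm $\|u\|_E=q(u)^{1/2}$, and $q(\cdot,\cdot)$ denotes the associated bilinear form. A subset $\mathcal K\subset\mathcal V$ is a canonically compactifiable subset, written $\mathcal K\Subset\mathcal V$, if $u\mapsto\chi_{\mathcal K}u$ is a continuous operator $D(q^{(N)})\to\ell^\infty$. $\Gamma$ is canonically compactifiable if $D(q^{(N)})$ embeds continuously into $\ell^\infty$. Growth assumption on the potential (standing): $\sup_{\mathcal K\Subset\mathcal V,\ m(\mathcal K)<\infty}\ \inf_{x\in\mathcal V\setminus\mathcal K}V(x)=\infty$ (with $\inf\emptyset=+\infty$). Assumptions on $f$, with $F(x,u)=\int_0^uf(x,s)\,ds$: $(f_1)$ $u\mapsto f(x,u)$ is continuous (and measurable) and $f(x,0)=0$ for all $x$. $(f_2)$ For all $x\in\mathcal V$, $|f(x,u)|\le\mu(R)|u|$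 whenever $|u|\le R$, where $\mu$ is non-decreasing, $\mu(R)>0$ for $R>0$, and $\mu(R)\to0=\mu(0)$ as $R\to0$. $(f_3)$ For each $x$, $u\mapsto f(x,u)/|u|$ (extended by $0$ to $u=0$) is strictly increasing on $\mathbb R$. $(f_4)$ $F(x,u)/u^2\to\infty$ as $|u|\to\infty$ for all $x\in\mathcal V$. A solution in $E$ is understood as a critical point $u\in E$ of $J_\lambda(u)=\frac12\left(q(u)-\lambda\|u\|_{\ell^2_m}^2\right)-\kappa\sum_x m(x)F(x,u(x))$, i.e. $q(u,v)-\lambda(u,v)_m=\kappa\sum_x m(x)f(x,u(x))v(x)$ for all $v\in E$. *)

(* Defs.v *)
(* Weighted graphs and their quadratic forms, in MathComp-Analysis. *)
From HB Require Import structures.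
From mathcomp Require Import all_boot all_order all_algebra.
From mathcomp Require Import all_classical all_reals all_analysis.

Set Implicit Arguments.
Unset Strict Implicit.
Unset Printing Implicit Defensive.

Import Order.TTheory GRing.Theory Num.Theory.
Import numFieldNormedType.Exports.

Local Open Scope classical_set_scope.
Local Open Scope ring_scope.

(* [esum] is the sum of a nonnegative family; this is its signed real version,
   meaningful when [f] is absolutely summable on [D]. *)
Definition rsum (R : realType) (V : choiceType) (D : set V) (f : V -> R) : R :=
  fine (\esum_(x in D) ((EFin \o f)^\+ x)%E) -
  fine (\esum_(x in D) ((EFin \o f)^\- x)%E).

Record weighted_graph (R : realType) (V : countType) := WeightedGraph {
  edge : V -> V -> R;
  killing : V -> R;
  edge_ge0 : forall x y, 0 <= edge x y;
  edge_diag : forall x, edge x x = 0;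
  edge_sym : forall x y, edge x y = edge y x;
  edge_summable : forall x, (\esum_(y in [set: V]) (edge x y)%:E < +oo)%E;
  killing_ge0 : forall x, 0 <= killing x
}.

Section spaces.
Context (R : realType) (V : countType) (m : V -> R).

Definition mass (A : set V) : \bar R := (\esum_(x in A) (m x)%:E)%E.

Definition ellp (p : \bar R) : set (V -> R) :=
  match p with
  | p'%:E => [set u | (\esum_(x in [set: V]) (m x * `|u x| `^ p')%:E < +oo)%E]
  | +oo%E => [set u | exists M : R, forall x, `|u x| <= M]
  | -oo%E => set0
  end.

Definition l2norm_sq (u : V -> R) : \bar R :=
  (\esum_(x in [set: V]) (m x * u x ^+ 2)%:E)%E.

Definition sup_norm (u : V -> R) : \bar R :=
  ereal_sup [set `|u x|%:E | x in [set: V]].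

Definition l2dot (u v : V -> R) : R :=
  rsum [set: V] (fun x => m x * u x * v x).

Definition restrict_to (K : set V) (u : V -> R) : V -> R :=
  fun x => \1_K x * u x.

(* [T] is continuous from the space [D] with norm [N] to ell^oo. *)
Definition continuous_to_linfty (D : set (V -> R)) (N : (V -> R) -> \bar R)
    (T : (V -> R) -> V -> R) : Prop :=
  (forall u, D u -> ellp +oo%E (T u)) /\
  (forall u, D u -> forall e : R, 0 < e ->
     exists2 d : R, 0 < d & forall v, D v ->
       (N (v \- u)%R < d%:E)%E -> (sup_norm (T v \- T u)%R < e%:E)%E).

(* A symmetric bilinear form with its domain; the values of [fval] outside
   [fdom] are irrelevant. The quadratic form is [fun u => fval q u u]. *)
Record sym_form := SymForm {
  fdom : set (V -> R);
  fval : (V -> R) -> (V -> R) -> R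
}.

Definition form_norm_sq (q : sym_form) (u : V -> R) : \bar R :=
  ((fval q u u)%:E + l2norm_sq u)%E.

Record closed_form (q : sym_form) : Prop := ClosedForm {
  cf_l2 : fdom q `<=` ellp 2%:E;
  cf_dom0 : fdom q (fun=> 0);
  cf_domD : forall (a : R) u v, fdom q u -> fdom q v ->
    fdom q (fun x => a * u x + v x);
  cf_sym : forall u v, fdom q u -> fdom q v -> fval q u v = fval q v u;
  cf_lin : forall (a : R) u v w, fdom q u -> fdom q v -> fdom q w ->
    fval q (fun x => a * u x + v x) w = a * fval q u w + fval q v w;
  cf_ge0 : forall u, fdom q u -> 0 <= fval q u u;
  cf_complete : forall u_ : nat -> V -> R, (forall n, fdom q (u_ n)) ->
    form_norm_sq q (u_ nk.1 \- u_ nk.2) @[nk --> (\oo, \oo)] --> 0%E ->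
    exists2 u, fdom q u & form_norm_sq q (u_ n \- u) @[n --> \oo] --> 0%E
}.

End spaces.

Section graph.
Context (R : realType) (V : countType) (m : V -> R) (G : weighted_graph R V).

Local Notation b := (edge G).
Local Notation c := (killing G).

Definition adj (x y : V) : Prop := 0 < b x y.

Definition potential (x : V) : R := (c x + m x) / m x.

Definition laplacian (u : V -> R) (x : V) : R :=
  (m x)^-1 * rsum [set y | adj x y] (fun y => b x y * (u y - u x)).

Definition qN (u : V -> R) : \bar R :=
  ((2^-1)%:E *
     (\esum_(xy in [set xy : V * V | adj xy.1 xy.2])
        (b xy.1 xy.2 * (u xy.2 - u xy.1) ^+ 2)%:E)
   + (\esum_(x in [set: V]) (m x * potential x * u x ^+ 2)%:E))%E.

Definition qN_dom : set (V -> R) := [set u | ellp m 2%:E u /\ (qN u < +oo)%E].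

Definition qN_norm (u : V -> R) : \bar R := (qN u `^ 2^-1)%E.

Definition finitely_supported (u : V -> R) : Prop :=
  finite_set [set x | u x != 0].

Definition q0 (u : V -> R) : R :=
  \sum_(x \in [set: V]) m x * (- laplacian u x + potential x * u x) * u x.

(* Domain of the closure of [q0] in ell^2: limits in ell^2 of [q0]-Cauchy
   sequences of finitely supported functions. *)
Definition qD_dom : set (V -> R) :=
  [set u | ellp m 2%:E u /\ exists phi : nat -> V -> R,
    [/\ forall n, finitely_supported (phi n),
        l2norm_sq m (phi n \- u) @[n --> \oo] --> 0%E &
        q0 (phi nk.1 \- phi nk.2) @[nk --> (\oo, \oo)] --> (0 : R)]].

(* The forms [q] between the Dirichlet form and the Neumann form. *)
Definition admissible_form (q : sym_form R V) : Prop :=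
  [/\ closed_form m q, qD_dom `<=` fdom q, fdom q `<=` qN_dom &
      forall u, fdom q u -> (fval q u u)%:E = qN u].

Definition cc_subset (K : set V) : Prop :=
  continuous_to_linfty m qN_dom qN_norm (restrict_to K).

Definition canonically_compactifiable : Prop :=
  continuous_to_linfty m qN_dom qN_norm id.

(* [ereal_inf set0 = +oo], the convention needed when [K] is everything. *)
Definition potential_growth : Prop :=
  ereal_sup
    [set ereal_inf [set (potential x)%:E | x in ~` K]
       | K in [set K | cc_subset K /\ (mass m K < +oo)%E]] = +oo%E.

End graph.

Section nonlinearity.
Context (R : realType) (V : countType) (f : V -> R -> R).

(* F(x, u), the oriented integral of f(x, _) from 0 to u *)
Definition primitive (x : V) (u : R) : R :=
  if 0 <= u then \int[lebesgue_measure]_(s in `[0, u]) f x s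
  else - \int[lebesgue_measure]_(s in `[u, 0]) f x s.

Definition cond_f1 : Prop :=
  forall x, [/\ continuous (f x), measurable_fun [set: R] (f x) & f x 0 = 0].

Definition cond_f2 : Prop :=
  exists mu : R -> R,
    [/\ forall r s : R, 0 <= r -> r <= s -> mu r <= mu s,
        forall r : R, 0 < r -> 0 < mu r,
        mu 0 = 0, mu r @[r --> 0^'+] --> (0 : R) &
        forall x (r u : R), `|u| <= r -> `|f x u| <= mu r * `|u|].

Definition cond_f3 : Prop :=
  forall x, {homo (fun u : R => if u == 0 then 0 else f x u / `|u|)
                : u v / u < v}.

Definition cond_f4 : Prop :=
  forall x,
    (primitive x u / u ^+ 2 @[u --> +oo_R] --> +oo_R) /\
    (primitive x u / u ^+ 2 @[u --> -oo_R] --> +oo_R).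

End nonlinearity.

(* Critical points of
   J(u) = (q(u) - lambda ||u||_2^2) / 2 - kappa * sum_x m(x) F(x, u(x))
   on [fdom q], i.e. solutions of the weak equation. *)
Definition solution (R : realType) (V : countType) (m : V -> R)
    (q : sym_form R V) (f : V -> R -> R) (lambda kappa : R) (u : V -> R) : Prop :=
  fdom q u /\
  forall v, fdom q v ->
    fval q u v - lambda * l2dot m u v =
    kappa * rsum [set: V] (fun x => m x * f x (u x) * v x).

(* Main.v *)
(* Since m + c = m V, finiteness of q^(N)(u) bounds sum (m + c) u^2. Splitting
   m |u| by AM-GM as m^2 / (m + c) + (m + c) u^2 off K and as m + m u^2 on K
   puts u in ell^1. Canonical compactifiability makes u bounded, and ell^1 and
   ell^oo together give every ell^p. *)
Require Import Defs.
From HB Require Import structures.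
From mathcomp Require Import all_boot all_order all_algebra.
From mathcomp Require Import all_classical all_reals all_analysis.
From mathcomp Require Import ring.

Set Implicit Arguments.
Unset Strict Implicit.
Unset Printing Implicit Defensive.

Import Order.TTheory GRing.Theory Num.Theory.
Import numFieldNormedType.Exports.

Local Open Scope classical_set_scope.
Local Open Scope ring_scope.

(** Each finite partial sum scales exactly, and is then bounded by [r] times the supremum. *)
Lemma le_esumZl (R : realType) (T : choiceType) (A : set T) (r : R)
    (a : T -> \bar R) : 0 <= r -> (forall x, 0 <= a x)%E ->
  (\esum_(x in A) (r%:E * a x) <= r%:E * \esum_(x in A) a x)%E.
Proof.
move=> r0 a0; apply: ub_ereal_sup => _ [X AX <-].
rewrite -ge0_mule_fsumr// lee_wpmul2l ?lee_fin//.
by apply: ereal_sup_ubound; exists X.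
Qed.

Lemma le_esum_setT (R : realType) (T : choiceType) (A : set T)
    (a : T -> \bar R) : (forall x, 0 <= a x)%E ->
  (\esum_(x in A) a x <= \esum_(x in [set: T]) a x)%E.
Proof.
by move=> a0; rewrite [leRHS](esumID A)// setTI leeDl// esum_ge0.
Qed.

Section ell1.
Context (R : realType) (V : countType) (m : V -> R) (m_gt0 : forall x, 0 < m x).

(** For finite [p], a bound [M] on [|u|] gives [|u|^p = |u|^(p-1) |u| <= M^(p-1) |u|], and the
    constant comes out of the sum. *)
Lemma ell1_bounded_ellp (u : V -> R) (p : \bar R) :
  (1 <= p)%E -> ellp m 1%:E u -> ellp m +oo%E u -> ellp m p u.
Proof.
case: p => [p| |] //; rewrite lee_fin => p1 /= u1 [M uM].
(* A nonzero total exponent lets [powRD] split the power even where [u x = 0]. *)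
have p0 : p - 1 + 1 != 0 by rewrite subrK gt_eqF// (lt_le_trans ltr01).
apply: (@le_lt_trans _ _
  (\esum_(x in [set: V]) ((M `^ (p - 1))%:E * (m x * `|u x| `^ 1)%:E))%E).
  apply: le_esum => x _; rewrite -EFinM lee_fin mulrCA ler_wpM2l ?(ltW (m_gt0 _))//.
  rewrite -[in leLHS](subrK 1 p) [leLHS]powRD ?(negbTE p0)// ler_wpM2r ?powR_ge0//.
  have M0 : 0 <= M := le_trans (normr_ge0 _) (uM x).
  by apply: ge0_ler_powR; rewrite ?nnegrE ?subr_ge0.
apply: le_lt_trans (le_esumZl _ _ _) _; rewrite ?powR_ge0//.
  by move=> x; rewrite lee_fin mulr_ge0 ?powR_ge0 ?ltW.
by rewrite lte_mul_pinfty ?lee_fin ?powR_ge0.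
Qed.

(** This sum is the potential part of [qN], and the edge part is nonnegative. *)
Lemma qN_dom_potential_summable (G : weighted_graph R V) (u : V -> R) :
  qN_dom m G u ->
  (\esum_(x in [set: V]) ((m x + killing G x) * u x ^+ 2)%:E < +oo)%E.
Proof.
move=> [_]; apply: le_lt_trans; rewrite /qN.
under eq_esum => x _.
  rewrite (_ : (_ + _)%R = m x * potential m G x); last first.
    by rewrite /potential mulrCA divff ?gt_eqF// mulr1 addrC.
  over.
rewrite leeDr// mule_ge0 ?lee_fin// esum_ge0// => -[x y] /= _.
by rewrite lee_fin mulr_ge0 ?edge_ge0 ?sqr_ge0.
Qed.

Lemma qN_dom_ell1 (G : weighted_graph R V) (K : set V) (u : V -> R) :
  (mass m K < +oo)%E ->
  (\esum_(x in ~` K) (m x ^+ 2 / (m x + killing G x))%:E < +oo)%E ->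
  qN_dom m G u -> ellp m 1%:E u.
Proof.
move=> Koo KCoo /qN_dom_potential_summable u2 /=.
have w0 x : 0 < m x + killing G x by rewrite ltr_wpDr ?killing_ge0.
have u2_ge0 x : (0 <= ((m x + killing G x) * u x ^+ 2)%:E)%E.
  by rewrite lee_fin mulr_ge0 ?sqr_ge0 ?ltW.
have u2_sub A :
  (\esum_(x in A) ((m x + killing G x) * u x ^+ 2)%:E < +oo)%E.
  by apply: le_lt_trans u2; apply: le_esum_setT.
(* The difference of the two sides is a sum of squares divided by [w], obtained by completing the
   square in [a]. *)
have amgm (w a t : R) : 0 < w -> a * `|t| <= a ^+ 2 / w + w * t ^+ 2.
  move=> w_gt0; rewrite -(real_normK (num_real t)).
  have -> : a ^+ 2 / w + w * `|t| ^+ 2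
      = a * `|t| + ((a - w * `|t| / 2) ^+ 2 + 3 / 4 * (w * `|t|) ^+ 2) / w.
    by field; rewrite gt_eqF.
  rewrite lerDl divr_ge0 ?(ltW w_gt0)// addr_ge0 ?sqr_ge0//.
  by rewrite mulr_ge0 ?sqr_ge0// divr_ge0.
rewrite (esumID K) ?setTI; last first.
  by move=> x _; rewrite lee_fin mulr_ge0 ?powR_ge0 ?ltW.
rewrite lte_add_pinfty//.
(* On [K], take [a = w = m x]: the first term [m^2 / m = m] sums to the mass of [K], and [m u^2] is
   enlarged to [(m + c) u^2]. *)
- apply: (@le_lt_trans _ _ (\esum_(x in K) ((m x)%:E +
      ((m x + killing G x) * u x ^+ 2)%:E))%E).
    apply: le_esum => x _; rewrite -EFinD lee_fin powRr1//.
    apply: le_trans (amgm _ _ _ (m_gt0 x)) _.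
    rewrite expr2 mulfK ?gt_eqF// lerD2l ler_wpM2r ?sqr_ge0//.
    by rewrite lerDl killing_ge0.
  rewrite esumD//; last by move=> x _; rewrite lee_fin ltW.
  by rewrite lte_add_pinfty.
(* Off [K], whose mass may be infinite, take [a = m x] and [w = m x + killing G x], so that the
   first term is the tail sum. *)
- apply: (@le_lt_trans _ _ (\esum_(x in ~` K)
      ((m x ^+ 2 / (m x + killing G x))%:E +
       ((m x + killing G x) * u x ^+ 2)%:E))%E).
    by apply: le_esum => x _; rewrite -EFinD lee_fin powRr1// amgm.
  rewrite esumD//; last by move=> x _; rewrite lee_fin divr_ge0 ?sqr_ge0 ?ltW.
  by rewrite lte_add_pinfty.
Qed.

End ell1.

Theorem corollary2p12 (R : realType) (V : countType)
    (V_infinite : infinite_set [set: V])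
    (m : V -> R) (m_gt0 : forall x, 0 < m x)
    (G : weighted_graph R V)
    (G_cc : canonically_compactifiable m G)
    (G_growth : potential_growth m G)
    (q : sym_form R V) (q_adm : admissible_form m G q)
    (f : V -> R -> R)
    (f1 : cond_f1 f) (f2 : cond_f2 f) (f3 : cond_f3 f) (f4 : cond_f4 f)
    (lambda kappa : R) (kappaE : kappa = 1 \/ kappa = -1)
    (tail_finite :
       (ereal_inf
          [set \esum_(x in ~` K) (m x ^+ 2 / (m x + killing G x))%:E
             | K in [set K : set V | mass m K < +oo]] < +oo)%E)
    (u : V -> R) (u_sol : solution m q f lambda kappa u)
    (p : \bar R) (p_ge1 : (1 <= p)%E) :
  ellp m p u.
Proof.
have [_ _ q_qN _] := q_adm; have /q_qN u_qN := u_sol.1.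
(* An infimum below [+oo] is witnessed by one [K] of finite mass with finite tail sum. *)
have [_ [K Koo <-] KCoo] := ereal_inf_lt tail_finite.
apply: ell1_bounded_ellp => //; first exact: qN_dom_ell1 Koo KCoo u_qN.
(* The embedding of the Neumann domain into bounded functions applies to [u]. *)
exact: G_cc.1.
Qed.
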